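(* Let $q$ be a prime power and let $\mathcal{M}_q$ be the set of monic polynomials in $\mathbb{F}_q[T]$. For $f\in\mathcal{M}_q$ of degree $n\ge1$ let $P_{GL}(f)=|\{M\in\mathrm{GL}(n,\mathbb{F}_q):\det(T-M)=f\}|/|\mathrm{GL}(n,\mathbb{F}_q)|$, and set $P_{GL}(1)=1$. For $i\ge1$ define $\alpha_i^{GL}:\mathcal{M}_q\to\mathbb{R}$ by $\alpha_i^{GL}(g)=|g|^{-i}$ if $g(0)\ne0$ and $\alpha_i^{GL}(g)=0$ if $g(0)=0$. Then for every $f\in\mathcal{M}_q$, $$P_{GL}(f)=\lim_{k\to\infty}(\alpha_1^{GL}\ast\alpha_2^{GL}\ast\cdots\ast\alpha_k^{GL})(f).$$
   Context: $|g|=q^{\deg g}$ for $g\in\mathcal{M}_q$. The Dirichlet convolution of functions $\alpha,\beta:\mathcal{M}_q\to\mathbb{C}$ is $(\alpha\ast\beta)(f)=\sum_{g,h\in\mathcal{M}_q,\ gh=f}\alpha(g)\beta(h)$. *)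

(* Defs.v *)
From HB Require Import structures.
From mathcomp Require Import all_boot all_order all_algebra.
From mathcomp Require Import all_classical all_reals all_analysis.
Set Implicit Arguments. Unset Strict Implicit. Unset Printing Implicit Defensive.
Import Order.TTheory GRing.Theory Num.Theory.
Local Open Scope ring_scope.

Section Defs.
Variables (F : finFieldType) (R : realType).

Definition monic_of (d : nat) (t : {ffun 'I_d -> F}) : {poly F} :=
  'X^d + \sum_(i < d) t i *: 'X^i.

(* Dirichlet convolution on monic polynomials:
   (a * b)(f) = sum over monic g, h with g h = f of a(g) b(h).
   Every monic g, h with g h = f has degree <= deg f < size f, and every
   monic polynomial of degree d is monic_of d t for exactly one t. *)
Definition dconv (a b : {poly F} -> R) (f : {poly F}) : R :=
  \sum_(d < size f) \sum_(t : {ffun 'I_d -> F})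
  \sum_(e < size f) \sum_(s : {ffun 'I_e -> F})
    (if monic_of t * monic_of s == f
     then a (monic_of t) * b (monic_of s) else 0).

Definition pabs (g : {poly F}) : R := (#|F|%:R) ^+ (size g).-1.

Definition alphaGL (i : nat) (g : {poly F}) : R :=
  if g.[0] != 0 then (pabs g) ^- i else 0.

Definition deltaP (g : {poly F}) : R := if g == 1 then 1 else 0.

Fixpoint alpha_conv (k : nat) : {poly F} -> R :=
  match k with
  | 0 => deltaP
  | k'.+1 => dconv (alpha_conv k') (alphaGL k'.+1)
  end.

Definition PGL (f : {poly F}) : R :=
  let n := (size f).-1 in
  if n == 0%N then 1 else
  (#|[set M : 'M[F]_n | (M \in unitmx) && (char_poly M == f)]|%:R /
   #|[set M : 'M[F]_n | M \in unitmx]|%:R).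

End Defs.

(* Main.v *)
Require Import Defs.
From HB Require Import structures.
From mathcomp Require Import all_boot all_order all_algebra.
From mathcomp Require Import all_classical all_reals all_analysis.
Set Implicit Arguments. Unset Strict Implicit. Unset Printing Implicit Defensive.
Import Order.TTheory GRing.Theory Num.Theory.
Import numFieldNormedType.Exports.
Local Open Scope ring_scope.

(* Let f be monic of degree n with f(0) <> 0, and count the pairs (M, v) where M
   is an n x n matrix with characteristic polynomial f and v is a vector, in two
   ways.  There are q^n choices of v for each M.  On the other hand, sort the
   pairs by the cyclic subspace generated by v: if its dimension is d, then M
   restricted to it is the companion matrix of a monic divisor g of f of degree
   d, and M acts on the quotient with characteristic polynomial h = f / g.
   Dividing by |GL_n| gives |f| P(f) = sum_(h | f) P(h), that is,
   P = alpha_1 * (P / |.|).  Since multiplication by |.|^-k distributes over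
   Dirichlet convolution, iterating yields
     P = (alpha_1 * ... * alpha_k) * (P / |.|^k),
   whose term h = 1 is (alpha_1 * ... * alpha_k)(f) and whose other terms add up
   to a number between 0 and q^-k (P * P)(f). *)

(** * Characteristic polynomials under block triangular form and conjugation *)

Lemma char_poly_lblock (R : comNzRingType) n1 n2 (A : 'M[R]_n1)
    (B : 'M[R]_(n2, n1)) (D : 'M[R]_n2) :
  char_poly (block_mx A 0 B D) = char_poly A * char_poly D.
Proof.
rewrite /char_poly /char_poly_mx map_block_mx scalar_mx_block opp_block_mx.
by rewrite add_block_mx map_mx0 subr0 det_lblock.
Qed.

Lemma char_poly_conj (R : comUnitRingType) n (P N : 'M[R]_n) :
  P \in unitmx -> char_poly (invmx P *m N *m P) = char_poly N.
Proof.
move=> Pu; rewrite /char_poly.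
have PVP : map_mx polyC (invmx P) *m map_mx polyC P = 1%:M.
  by rewrite -map_mxM mulVmx // map_mx1.
have -> : char_poly_mx (invmx P *m N *m P) =
    map_mx polyC (invmx P) *m char_poly_mx N *m map_mx polyC P.
  rewrite /char_poly_mx mulmxBr mulmxBl !map_mxM; congr (_ - _).
  by rewrite mul_mx_scalar -scalemxAl PVP scalemx1.
by rewrite !det_mulmx mulrAC -det_mulmx PVP det1 mul1r.
Qed.

(** * Monic polynomials as coefficient vectors *)

Lemma monic_size1 (R : nzRingType) (f : {poly R}) :
  f \is monic -> size f = 1%N -> f = 1.
Proof.
move=> fm /eqP/size_poly1P[c _ fc]; move: fm.
by rewrite monicE fc lead_coefC => /eqP->.
Qed.

Lemma monic_ofE (F : finFieldType) d (t : {ffun 'I_d -> F}) :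
  [/\ monic_of t \is monic, size (monic_of t) = d.+1 &
      forall i : 'I_d, (monic_of t)`_i = t i].
Proof.
have E : \sum_(i < d) t i *: 'X^i =
         \poly_(i < d) (if insub i is Some j then t j else 0).
  by rewrite poly_def; apply: eq_bigr => i _; rewrite valK.
have lt : (size (\sum_(i < d) t i *: 'X^i)%R < size ('X^d : {poly F})%R)%N.
  by rewrite size_polyXn ltnS E size_poly.
split.
- by rewrite monicE lead_coefDl // lead_coefXn.
- by rewrite size_polyDl // size_polyXn.
- by move=> i; rewrite coefD coefXn E coef_poly ltn_ord valK ltn_eqF ?add0r.
Qed.

Lemma monic_of_inj (F : finFieldType) d : injective (@monic_of F d).
Proof.
move=> s t est; apply/ffunP => i.
by have [_ _ <-] := monic_ofE t; have [_ _ <-] := monic_ofE s; rewrite est.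
Qed.

Lemma monic_of_surj (F : finFieldType) d (g : {poly F}) :
  g \is monic -> size g = d.+1 -> exists t : {ffun 'I_d -> F}, monic_of t = g.
Proof.
move=> gm gs; exists [ffun i : 'I_d => g`_i].
have [tm ts tE] := monic_ofE [ffun i : 'I_d => g`_i].
apply/polyP => i; case: (ltngtP i d) => [id|di|->].
- by rewrite (tE (Ordinal id)) ffunE.
- by rewrite !nth_default ?ts ?gs.
- by move: tm gm; rewrite !monicE /lead_coef ts gs /= => /eqP-> /eqP->.
Qed.

(** * Companion matrices and Krylov sequences *)

Section Counting.
Variable F : finFieldType.

(* companionmx with its dimension as a parameter: companionmx p lives in
   'M_(size p).-1, which is d only propositionally. *)
Definition compmx d (p : {poly F}) : 'M[F]_d :=
  \matrix_(i, j) if i == d.-1 :> nat then - p`_j else (i.+1 == j :> nat)%:R.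

Lemma char_poly_compmx d (p : {poly F}) :
  p \is monic -> size p = d.+1 -> char_poly (compmx d p) = p.
Proof.
move=> pm ps; have ed : d = (size p).-1 by rewrite ps.
by subst d; exact: companionmxK.
Qed.

Lemma row_compmx d n (p : {poly F}) (K : 'M[F]_(d, n)) (i : 'I_d) (lt : (i.+1 < d)%N) :
  row i (compmx d p *m K) = row (Ordinal lt) K.
Proof.
rewrite row_mul; have -> : row i (compmx d p) = delta_mx 0 (Ordinal lt).
  apply/rowP => j; rewrite !mxE eqxx /= ltn_eqF ?ltn_predRL //.
  by rewrite -val_eqE /= eq_sym.
by rewrite -rowE.
Qed.

(** Stacking the orbit of v as rows turns linear independence into [row_free] and the span into a
    row space; matrices act on the right. *)
Definition krylov n d (x : 'M[F]_n * 'rV[F]_n) : 'M[F]_(d, n) :=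
  \matrix_(i < d) (x.2 *m x.1 ^+ i).

(* The cyclic subspace generated by v = x.2 under M = x.1 has dimension d. *)
Definition cyclic_dim n (d : nat) (x : 'M[F]_n * 'rV[F]_n) :=
  row_free (krylov d x) && ~~ row_free (krylov d.+1 x).

Lemma row_free_krylovS n d (x : 'M[F]_n * 'rV[F]_n) :
  row_free (krylov d.+1 x) -> row_free (krylov d x).
Proof.
move=> fr; apply: inj_row_free => v v0.
have : (row_mx v (0 : 'rV_1) : 'rV_(d + 1)) *m
    castmx (esym (addn1 d), erefl) (krylov d.+1 x) = 0.
  rewrite -[X in _ *m X]vsubmxK mul_row_col mul0mx addr0 -[RHS]v0.
  congr (_ *m _); apply/matrixP => i j.
  by rewrite mxE castmxE !mxE /= cast_ord_id.
move/eqP; rewrite mulmx_free_eq0 ?row_free_castmx // => /eqP e0.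
by move/(congr1 lsubmx): e0; rewrite row_mxKl linear0.
Qed.

(** Independence of the first d Krylov vectors holds at d = 0, fails at d = n + 1 and, once lost,
    stays lost. It therefore stops at exactly one d, and the sum telescopes. *)
Lemma sum_cyclic_dim n (x : 'M[F]_n * 'rV[F]_n) :
  (\sum_(d < n.+1) cyclic_dim d x = 1)%N.
Proof.
have rf0 : row_free (krylov 0 x).
  by rewrite /row_free; apply/eqP; apply/eqP; rewrite -leqn0 rank_leq_row.
have rfn : row_free (krylov n.+1 x) = false.
  by apply/negP => /eqP r; have := rank_leq_col (krylov n.+1 x); rewrite r ltnn.
suff H m : (\sum_(d < m) cyclic_dim d x + row_free (krylov m x) = 1)%N.
  by have := H n.+1; rewrite rfn addn0.
elim: m => [|m IH]; first by rewrite big_ord0 rf0.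
rewrite big_ord_recr /= -[RHS]IH -addnA; congr addn.
rewrite /cyclic_dim; have := @row_free_krylovS n m x.
by case: (row_free (krylov m.+1 x)) => [->//|_]; rewrite andbT addn0.
Qed.

(** All rows but the last merely shift the sequence; the last one is the relation c, with the sign
    that [compmx] puts on the coefficients of p. *)
Lemma krylov_step n d (x : 'M[F]_n * 'rV[F]_n) (c : 'rV_d) :
  (0 < d)%N -> x.2 *m x.1 ^+ d = c *m krylov d x ->
  forall p : {poly F}, (forall i : 'I_d, p`_i = - c 0 i) ->
  krylov d x *m x.1 = compmx d p *m krylov d x.
Proof.
move=> d0 cE p pE; apply/row_matrixP => i.
rewrite row_mul rowK -mulmxA -[_ *m x.1]exprSr.
have := ltn_ord i; rewrite leq_eqVlt => /orP[/eqP ei|lt].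
  rewrite ei cE row_mul; congr (_ *m _); apply/rowP => j.
  by rewrite !mxE (_ : i == d.-1 :> nat) ?pE ?opprK // -[in X in _ == X]ei.
by rewrite row_compmx rowK.
Qed.

(** All rows but the last of the intertwining relation say that M sends each row of K to the next,
    so the first row determines K. *)
Lemma krylov_unique n d (M : 'M[F]_n) (v : 'rV_n) (K : 'M[F]_(d, n)) (p : {poly F})
   (d0 : (0 < d)%N) :
  K *m M = compmx d p *m K -> row (Ordinal d0) K = v -> K = krylov d (M, v).
Proof.
move=> KM Kv; apply/row_matrixP => -[i id]; rewrite rowK /=.
elim: i id => [|i IH] id.
  by rewrite expr0 mulmx1 -Kv; congr row; apply/val_inj.
rewrite exprSr mulmxA -(IH (ltnW id)) -row_mul KM row_compmx.
by congr row; apply/val_inj.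
Qed.


(** * Counting pairs through adapted bases *)

Lemma block_lower_unit d m (B : 'M[F]_(m, d)) (D : 'M[F]_m) :
  (block_mx 1%:M 0 B D \in unitmx) = (D \in unitmx).
Proof. by rewrite !unitmxE det_lblock det1 mul1r. Qed.

(** Full row rank makes the middle factor of the rank factorization of K equal to (1 0); P undoes
    the two invertible outer factors. *)
Lemma free_completion d m (K : 'M[F]_(d, d + m)) :
  row_free K -> exists2 P : 'M[F]_(d + m), P \in unitmx & K *m P = row_mx 1%:M 0.
Proof.
move=> /eqP rK.
have Lu := col_ebase_unit K; have Ru := row_ebase_unit K.
have E := mulmx_ebase K; rewrite rK in E.
have pE : pid_mx d = row_mx 1%:M 0 :> 'M[F]_(d, d + m).
  apply/matrixP => i j; rewrite mxE -(fintype.splitK j); case: (fintype.split j) => k.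
    by rewrite row_mxEl mxE /= ltn_ord andbT.
  by rewrite row_mxEr mxE /= ltn_eqF // ltn_addr.
exists (invmx (row_ebase K) *m block_mx (invmx (col_ebase K)) 0 0 1%:M).
  by rewrite unitmx_mul unitmx_inv Ru /= block_diag_mx_unit unitmx_inv Lu unitmx1.
rewrite -[X in X *m _]E mulmxA mulmxK // pE -mulmxA mul_row_block !mul1mx !mul0mx.
by rewrite !addr0 mul_mx_row mulmx0 mulmxV.
Qed.

(** After a change of basis taking K to (1 0), a completion has blocks 1, 0 over B, D, with B
    arbitrary and D invertible. *)
Lemma card_completions d m (K : 'M[F]_(d, d + m)) : row_free K ->
  #|[set P : 'M[F]_(d + m) | (P \in unitmx) && (usubmx P == K)]|
  = (#|F| ^ (m * d) * #|[set D : 'M[F]_m | D \in unitmx]|)%N.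
Proof.
case/free_completion=> Q Qu KQ.
pose g (x : 'M[F]_(m, d) * 'M[F]_m) := block_mx 1%:M 0 x.1 x.2 *m invmx Q.
have gI : injective g.
  move=> [B D] [B' D'] /(can_inj (mulmxKV Qu)) /eq_block_mx[_ _ /= -> ->] //.
have -> : (#|F| ^ (m * d) * #|[set D : 'M[F]_m | D \in unitmx]|)%N =
    #|finset.setX [set: 'M[F]_(m, d)] [set D : 'M[F]_m | D \in unitmx]|.
  by rewrite cardsX cardsT card_mx.
rewrite -(card_imset _ gI).
apply: eq_card => P; rewrite inE.
apply/andP/imsetP => [[Pu /eqP PK]|[[B D]]].
  have E : P *m Q = block_mx 1%:M 0 (dlsubmx (P *m Q)) (drsubmx (P *m Q)).
    rewrite -[LHS]submxK /ulsubmx /ursubmx -mul_usub_mx PK KQ.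
    by rewrite row_mxKl row_mxKr.
  exists (dlsubmx (P *m Q), drsubmx (P *m Q)); last first.
    by rewrite /g /= -E mulmxK.
  rewrite !inE /= -(@block_lower_unit d m (dlsubmx (P *m Q))) -E.
  by rewrite unitmx_mul Pu.
rewrite !inE /= => Du ->; split.
  by rewrite unitmx_mul block_lower_unit Du unitmx_inv.
by rewrite /g -mul_usub_mx /= /block_mx col_mxKu -KQ mulmxK.
Qed.

Lemma compmx_inj d (d0 : (0 < d)%N) (s t : {ffun 'I_d -> F}) :
  compmx d (monic_of s) = compmx d (monic_of t) -> s = t.
Proof.
move=> e; apply/ffunP => j; have id : (d.-1 < d)%N by rewrite prednK.
have := congr1 (fun A : 'M[F]_d => A (Ordinal id) j) e; rewrite !mxE eqxx => /oppr_inj.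
by have [_ _ ->] := monic_ofE s; have [_ _ ->] := monic_ofE t.
Qed.

Lemma krylov_not_free n d (x : 'M[F]_n * 'rV_n) (c : 'rV_d) :
  x.2 *m x.1 ^+ d = c *m krylov d x -> row_free (krylov d.+1 x) = false.
Proof.
move=> cE; apply/negP => /eqP r.
have : (krylov d.+1 x <= krylov d x)%MS.
  apply/row_subP => i; rewrite rowK.
  have := ltn_ord i; rewrite ltnS leq_eqVlt => /orP[/eqP->|lt].
    by rewrite cE submxMl.
  by have := row_sub (Ordinal lt) (krylov d x); rewrite rowK.
by move/mxrankS; rewrite r leqNgt ltnS rank_leq_row.
Qed.

(** If v M^d were outside the span of the earlier vectors, any relation among all d + 1 would have
    last coefficient zero, hence by independence would be trivial, against the failure of
    independence at d + 1. *)
Lemma cyclic_dim_relation n d (x : 'M[F]_n * 'rV_n) :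
  cyclic_dim d x -> exists c : 'rV_d, x.2 *m x.1 ^+ d = c *m krylov d x.
Proof.
case/andP => fr nfr; apply/submxP; apply: contraR nfr => nsub.
apply: inj_row_free => u u0.
pose w : 'rV_(d + 1) := castmx (erefl, esym (addn1 d)) u.
have : w *m col_mx (krylov d x) (x.2 *m x.1 ^+ d) = 0.
  rewrite -[RHS]u0; apply/rowP => j; rewrite !mxE.
  rewrite (reindex (cast_ord (esym (addn1 d)))) /=; last first.
    by exists (cast_ord (addn1 d)) => i _; apply/val_inj.
  apply: eq_bigr => i _; rewrite castmxE /= cast_ord_id cast_ordK; congr (_ * _).
  rewrite -[cast_ord _ i](fintype.splitK) [RHS]mxE.
  case: fintype.splitP => k /= ik.
    by rewrite col_mxEu mxE ik.
  by rewrite col_mxEd ik (ord1 k) addn0.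
rewrite -[w]hsubmxK mul_row_col => wK.
have r0 : rsubmx w = 0.
  have : rsubmx w *m (x.2 *m x.1 ^+ d) = (- lsubmx w) *m krylov d x.
    by apply/eqP; rewrite mulNmx -addr_eq0 addrC wK.
  rewrite [rsubmx w]mx11_scalar; have [->|nz] := eqVneq (rsubmx w 0 0) 0.
    by rewrite raddf0.
  rewrite mul_scalar_mx => /(congr1 (fun v => (rsubmx w 0 0)^-1 *: v)).
  rewrite scalerA mulVf // scale1r => E; case/negP: nsub.
  by rewrite E scalemx_sub // submxMl.
have l0 : lsubmx w = 0.
  move/eqP: wK; rewrite r0 mul0mx addr0 mulmx_free_eq0 //; exact/eqP.
have : w = 0 by rewrite -[w]hsubmxK l0 r0 row_mx0.
by move/(canRL (castmxK _ _)) => ->; apply/matrixP => i j; rewrite castmxE !mxE.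
Qed.

(* In a basis P whose first d rows are the Krylov vectors, M becomes block lower
   triangular with a companion matrix as its upper left block. *)
Lemma card_adapted_pairs d m (P : 'M[F]_(d + m)) (f : {poly F}) :
  (0 < d)%N -> P \in unitmx ->
  #|[set x : 'M[F]_(d + m) * 'rV[F]_(d + m) |
      [&& char_poly x.1 == f, cyclic_dim d x & usubmx P == krylov d x]]|
  = (#|F| ^ (m * d) * #|[set y : {ffun 'I_d -> F} * 'M[F]_m |
                          (monic_of y.1 * char_poly y.2 == f)%R]|)%N.
Proof.
move=> d0 Pu; pose N (z : {ffun 'I_d -> F} * 'M[F]_m * 'M[F]_(m, d)) :=
  block_mx (compmx d (monic_of z.1.1)) 0 z.2 z.1.2.
(* The vector is forced: a Krylov sequence starts with v, so v is the first row of P. *)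
pose g z := (invmx P *m N z *m P, row (Ordinal d0) (usubmx P)).
have gI : injective g.
  move=> [[t D] B] [[t' D'] B'] [] /(can_inj (mulmxK Pu)).
  have VPu : invmx P \in unitmx by rewrite unitmx_inv.
  by move=> /(can_inj (mulKmx VPu)) /eq_block_mx[/(compmx_inj d0) /= -> _ -> ->].
set S := [set y : {ffun 'I_d -> F} * 'M[F]_m | monic_of y.1 * char_poly y.2 == f].
have -> : (#|F| ^ (m * d) * #|S|)%N = #|finset.setX S [set: 'M[F]_(m, d)]|.
  by rewrite cardsX cardsT card_mx mulnC.
have PN z : P *m (g z).1 = N z *m P by rewrite /= !mulmxA mulmxV // mul1mx.
have cN z : char_poly (g z).1 = monic_of z.1.1 * char_poly z.1.2.
  have [tm ts _] := monic_ofE z.1.1.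
  by rewrite char_poly_conj // char_poly_lblock char_poly_compmx.
have frP : row_free (usubmx P).
  apply: inj_row_free => v v0.
  have : row_mx v (0 : 'rV_m) *m P = 0.
    by rewrite -[P]vsubmxK mul_row_col v0 mul0mx addr0.
  move/(congr1 (mulmx^~ (invmx P))); rewrite mulmxK // mul0mx.
  by move/(congr1 lsubmx); rewrite row_mxKl linear0.
rewrite -(card_imset _ gI); apply: eq_card => x; rewrite inE.
apply/and3P/imsetP => [[/eqP xf xd /eqP PK]|[[[t D] B]]].
  have [c cE] := cyclic_dim_relation xd.
  (* The signs are those of the polynomial X^d - sum c_i X^i, which sends v to 0 when evaluated at
     M. *)
  pose t := [ffun i => - c 0 i].
  have KM : usubmx P *m x.1 = compmx d (monic_of t) *m usubmx P.
    rewrite PK; apply: krylov_step cE _ _ => // i.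
    by have [_ _ ->] := monic_ofE t; rewrite ffunE.
  pose Q := P *m x.1 *m invmx P.
  pose z := (t, drsubmx Q, dlsubmx Q).
  have QN : Q = N z.
    have uQ : usubmx Q = row_mx (compmx d (monic_of t)) 0.
      rewrite -!mul_usub_mx KM -mulmxA mul_usub_mx mulmxV //.
      by rewrite scalar_mx_block /block_mx col_mxKu mul_mx_row mulmx1 mulmx0.
    by rewrite -[LHS]submxK /N /= /ulsubmx /ursubmx uQ row_mxKl row_mxKr.
  have xz : x = g z.
    rewrite /g -QN /Q !mulmxA mulVmx // mul1mx mulmxKV // [LHS]surjective_pairing.
    by congr pair; rewrite PK rowK /= expr0 mulmx1.
  by exists z => //; rewrite !inE andbT -[_ * _]cN -xz xf.
rewrite !inE andbT /= => tD ->.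
have UM : usubmx P *m (g (t, D, B)).1 = compmx d (monic_of t) *m usubmx P.
  rewrite mul_usub_mx PN /N /= -[X in _ *m X]vsubmxK mul_block_col col_mxKu.
  by rewrite mul0mx addr0.
have UK := krylov_unique (d0 := d0) UM erefl.
split; [by rewrite cN | | by rewrite UK].
have ld : (d.-1 < d)%N by rewrite prednK.
(* This relation stops the sequence at d: v M^(d-1) is the last of the first d rows of P, and M
   sends it to a combination of those rows. *)
have vd : (g (t, D, B)).2 *m (g (t, D, B)).1 ^+ d =
    row (Ordinal ld) (compmx d (monic_of t)) *m krylov d (g (t, D, B)).
  have -> : (g (t, D, B)).1 ^+ d = (g (t, D, B)).1 ^+ d.-1 *m (g (t, D, B)).1.
    by rewrite -[X in _ ^+ X](prednK d0) exprSr.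
  rewrite mulmxA.
  have -> : (g (t, D, B)).2 *m (g (t, D, B)).1 ^+ d.-1 = row (Ordinal ld) (usubmx P).
    by rewrite UK rowK.
  by rewrite -row_mul UM row_mul UK.
by rewrite /cyclic_dim -UK frP (krylov_not_free vd).
Qed.

(** Multiplied by q^(md), both sides count the (x, P) with x in the set on the left and P invertible
    with the Krylov vectors of x as its first d rows. Fixing x gives [card_completions]; fixing P
    gives [card_adapted_pairs]. *)
Lemma card_cyclic_pairs d m (f : {poly F}) : (0 < d)%N ->
  (#|[set x : 'M[F]_(d + m) * 'rV[F]_(d + m) |
       (char_poly x.1 == f) && cyclic_dim d x]|
    * #|[set D : 'M[F]_m | D \in unitmx]|
  = #|[set P : 'M[F]_(d + m) | P \in unitmx]|
    * #|[set y : {ffun 'I_d -> F} * 'M[F]_m |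
          (monic_of y.1 * char_poly y.2 == f)%R]|)%N.
Proof.
move=> d0; set X := [set x | _]; set Ud := [set D | _]; set Un := [set P | _].
set Y := [set y | _].
have q0 : (0 < #|F| ^ (m * d))%N by rewrite expn_gt0 (cardD1 0) inE.
apply/eqP; rewrite -(eqn_pmul2l q0); apply/eqP.
rewrite mulnCA [RHS]mulnCA -sum_nat_const -[RHS]sum_nat_const.
transitivity (\sum_(x in X) \sum_(P | (P \in unitmx) && (usubmx P == krylov d x)) 1)%N.
  apply: eq_bigr => x; rewrite inE => /andP[_ /andP[fr _]].
  by rewrite sum1dep_card card_completions.
rewrite (exchange_big_dep (mem Un)) /=; last by move=> x P _ /andP[]; rewrite inE.
apply: eq_bigr => P; rewrite inE => Pu.
rewrite -(card_adapted_pairs f d0 Pu) -sum1dep_card; apply: eq_bigl => x.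
by rewrite inE Pu /= -andbA.
Qed.

Lemma cyclic_dim0 n (x : 'M[F]_n * 'rV[F]_n) : cyclic_dim 0 x = (x.2 == 0).
Proof.
rewrite /cyclic_dim [row_free (krylov 0 x)]/row_free -leqn0 rank_leq_row /=.
have -> : krylov 1 x = x.2.
  by apply/row_matrixP => i; rewrite (ord1 i) rowK expr0 mulmx1 row_id.
by rewrite /row_free rank_rV eqb1 negbK.
Qed.

Lemma card_cyclic_pairs0 n (f : {poly F}) :
  #|[set x : 'M[F]_n * 'rV[F]_n | (char_poly x.1 == f) && cyclic_dim 0 x]|
  = #|[set M : 'M[F]_n | char_poly M == f]|.
Proof.
have inj0 : injective (fun M : 'M[F]_n => (M, 0 : 'rV[F]_n)) by move=> M N [].
rewrite -(card_imset _ inj0).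
apply: eq_card => -[M v]; rewrite inE cyclic_dim0 /=.
apply/andP/imsetP => [[Mf /eqP->]|[N]]; first by exists M; rewrite ?inE.
by rewrite inE => Nf [-> ->].
Qed.

Lemma card_char_poly_pairs n (f : {poly F}) :
  (#|F| ^ n * #|[set M : 'M[F]_n | char_poly M == f]| =
   \sum_(d < n.+1) #|[set x : 'M[F]_n * 'rV[F]_n |
                       (char_poly x.1 == f) && cyclic_dim d x]|)%N.
Proof.
have -> : (#|F| ^ n * #|[set M : 'M[F]_n | char_poly M == f]|)%N =
    #|finset.setX [set M : 'M[F]_n | char_poly M == f] [set: 'rV[F]_n]|.
  by rewrite cardsX cardsT card_mx mul1n mulnC.
rewrite -sum1_card.
under [RHS]eq_bigr do rewrite -sum1dep_card big_mkcondr.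
rewrite exchange_big /=.
apply: eq_big => [x|x _]; first by rewrite !inE andbT.
by rewrite -[LHS](sum_cyclic_dim x); apply: eq_bigr => d _; case: cyclic_dim.
Qed.

End Counting.

(** * The algebra of Dirichlet convolution *)

Section Convolution.
Variables (F : finFieldType) (R : realType).
Implicit Types (a b c : {poly F} -> R) (f g h : {poly F}).

(** A single flat list lets sums be exchanged and reindexed without tracking degrees in types. The
    bound N is on the size, so degrees stay below N. *)
Definition monics N : seq {poly F} :=
  [seq monic_of t | d <- iota 0 N, t <- enum {ffun 'I_d -> F}].

Lemma mem_monics N g : (g \in monics N) = (g \is monic) && (size g <= N)%N.
Proof.
apply/allpairsPdep/andP => [[d [t [dN _ ->]]]|[gm gN]].
  have [tm ts _] := monic_ofE t; rewrite tm ts; split=> //.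
  by move: dN; rewrite mem_iota.
have g0 : (0 < size g)%N by rewrite size_poly_gt0 monic_neq0.
have [t tg] := monic_of_surj gm (esym (prednK g0)).
exists (size g).-1, t; split; rewrite ?mem_enum // mem_iota /= add0n.
by rewrite prednK.
Qed.

Lemma monics_uniq N : uniq (monics N).
Proof.
apply: allpairs_uniq_dep => [|d _|]; rewrite ?iota_uniq ?enum_uniq //.
move=> [d t] [e s] _ _ /= ts; have de : d = e.
  have [_ + _] := monic_ofE t; have [_ + _] := monic_ofE s.
  by rewrite ts => -> [].
by subst e; rewrite (monic_of_inj ts).
Qed.

Lemma sum_monics N (G : {poly F} -> R) :
  \sum_(g <- monics N) G g = \sum_(d < N) \sum_(t : {ffun 'I_d -> F}) G (monic_of t).
Proof.
rewrite big_allpairs_dep.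
have -> : iota 0 N = index_iota 0 N by rewrite /index_iota subn0.
rewrite big_mkord.
by apply: eq_bigr => d _; rewrite big_enum.
Qed.

Lemma sum_monics_pick N g (G : {poly F} -> R) : g \in monics N ->
  \sum_(h <- monics N) (if h == g then G h else 0) = G g.
Proof.
move=> gN; rewrite (bigD1_seq g) ?monics_uniq //= eqxx big1 ?addr0 // => h.
by move/negPf->.
Qed.

Lemma sum_monics_widen N N' (G : {poly F} -> R) : (N <= N')%N ->
  (forall g, g \is monic -> (N < size g)%N -> G g = 0) ->
  \sum_(g <- monics N') G g = \sum_(g <- monics N) G g.
Proof.
move=> NN' G0; rewrite (bigID (fun g => size g <= N)%N) /= addrC.
rewrite big_seq_cond big1 ?add0r; last first.
  by move=> g; rewrite mem_monics -ltnNge => /andP[/andP[gm _]]; exact: G0.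
rewrite -big_filter; apply: perm_big; apply: uniq_perm.
- by rewrite filter_uniq ?monics_uniq.
- exact: monics_uniq.
move=> g; rewrite mem_filter !mem_monics; case: (g \is monic); rewrite ?andbF //=.
by case: leqP => // gN; rewrite (leq_trans gN).
Qed.

Lemma leq_size_monic_mull g h : g \is monic -> h \is monic ->
  (size g <= size (g * h)%R)%N.
Proof.
move=> gm hm; rewrite size_mul ?monic_neq0 // -subn1 -addnBA ?leq_addr //.
by rewrite size_poly_gt0 monic_neq0.
Qed.

Lemma leq_size_monic_mulr g h : g \is monic -> h \is monic ->
  (size h <= size (g * h)%R)%N.
Proof. by move=> gm hm; rewrite mulrC leq_size_monic_mull. Qed.

(** In a nested convolution the inner one is evaluated at a divisor of f; the freedom in N lets all
    the sums range over the same list. *)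
Lemma dconvE N a b f : (size f <= N)%N ->
  dconv a b f = \sum_(g <- monics N) \sum_(h <- monics N)
                  (if g * h == f then a g * b h else 0).
Proof.
move=> fN; rewrite (sum_monics_widen fN); last first.
  move=> g gm fg; rewrite big_seq big1 // => h; rewrite mem_monics => /andP[hm _].
  case: eqP => // ghf; move: (leq_size_monic_mull gm hm).
  by rewrite ghf leqNgt fg.
rewrite big_seq; under eq_bigr => g.
  rewrite mem_monics => /andP[gm _]; rewrite (sum_monics_widen fN); last first.
    move=> h hm fh; case: eqP => // ghf; move: (leq_size_monic_mulr gm hm).
    by rewrite ghf leqNgt fh.
  over.
rewrite -big_seq sum_monics; apply: eq_bigr => d _; apply: eq_bigr => t _.
by rewrite sum_monics.
Qed.

Lemma eq_dconv a a' b b' f :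
  {in monic, a =1 a'} -> {in monic, b =1 b'} -> dconv a b f = dconv a' b' f.
Proof.
move=> ea eb; rewrite !(dconvE _ _ (leqnn _)).
rewrite !big_seq; apply: eq_bigr => g; rewrite mem_monics => /andP[gm _].
rewrite !big_seq; apply: eq_bigr => h; rewrite mem_monics => /andP[hm _].
by rewrite ea ?eb.
Qed.

(** Summing out the intermediate product x = g h leaves the three factors on an equal footing. *)
Lemma dconv3l a b c f : dconv (dconv a b) c f =
  \sum_(g <- monics (size f)) \sum_(h <- monics (size f)) \sum_(k <- monics (size f))
    (if g * h * k == f then a g * b h * c k else 0).
Proof.
rewrite (dconvE _ _ (leqnn _)); set N := size f.
transitivity (\sum_(k <- monics N) \sum_(g <- monics N) \sum_(h <- monics N)
   \sum_(x <- monics N) (if (g * h == x) && (x * k == f) then a g * b h * c k else 0)).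
  rewrite exchange_big /=; apply: eq_bigr => k _.
  transitivity (\sum_(x <- monics N) \sum_(g <- monics N) \sum_(h <- monics N)
    (if (g * h == x) && (x * k == f) then a g * b h * c k else 0)).
    rewrite !big_seq; apply: eq_bigr => x; rewrite mem_monics => /andP[xm xN].
    case: eqP => xk; last first.
      by rewrite big1 // => g _; rewrite big1 // => h _; rewrite andbF.
    rewrite (dconvE _ _ xN) mulr_suml; apply: eq_bigr => g _.
    rewrite mulr_suml; apply: eq_bigr => h _; rewrite andbT.
    by case: eqP; rewrite ?mul0r.
  rewrite exchange_big /=; apply: eq_bigr => g _; exact: exchange_big.
rewrite exchange_big /= !big_seq; apply: eq_bigr => g.
rewrite mem_monics => /andP[gm _].
rewrite exchange_big /= !big_seq; apply: eq_bigr => h.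
rewrite mem_monics => /andP[hm _].
rewrite !big_seq; apply: eq_bigr => k; rewrite mem_monics => /andP[km _].
have ghm : g * h \is monic by rewrite monicMl.
case: (g * h * k =P f) => ghk; last first.
  by rewrite big1 // => x _; case: (g * h =P x) => // <-; case: eqP.
have ghN : g * h \in monics N.
  by rewrite mem_monics ghm /N -ghk leq_size_monic_mull.
rewrite -[RHS](sum_monics_pick (fun=> a g * b h * c k) ghN).
apply: eq_bigr => x _; rewrite [x == _]eq_sym.
by case: (g * h =P x) => // <-; rewrite ghk eqxx.
Qed.

Lemma dconvC a b f : dconv a b f = dconv b a f.
Proof.
rewrite !(dconvE _ _ (leqnn _)) exchange_big /=; apply: eq_bigr => h _.
by apply: eq_bigr => g _; rewrite mulrC [a g * _]mulrC.
Qed.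

(** Commutativity turns the left side into (b * c) * a, and both sides are then the same triple sum
    up to a permutation of the variables. *)
Lemma dconvA a b c f : dconv a (dconv b c) f = dconv (dconv a b) c f.
Proof.
rewrite dconvC !dconv3l; under eq_bigr => g _ do rewrite exchange_big /=.
rewrite exchange_big /=; apply: eq_bigr => g _; apply: eq_bigr => h _.
apply: eq_bigr => k _; rewrite -[h * k * g]mulrC mulrA.
by case: ifP => // _; rewrite -[b h * c k * a g]mulrC mulrA.
Qed.

Lemma dconv1 a f : f \is monic -> dconv (@deltaP F R) a f = a f.
Proof.
move=> fm; rewrite (dconvE _ _ (leqnn _)).
have f0 : (0 < size f)%N by rewrite size_poly_gt0 monic_neq0.
rewrite (bigD1_seq 1) ?monics_uniq ?mem_monics ?monic1 ?size_poly1 //=.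
rewrite [X in _ + X]big1 ?addr0 => [|g /negPf g1]; last first.
  by rewrite big1 // => h _; rewrite /deltaP g1 mul0r if_same.
rewrite -[RHS](@sum_monics_pick (size f)) ?mem_monics ?fm ?leqnn //.
by apply: eq_bigr => h _; rewrite mul1r /deltaP eqxx mul1r.
Qed.

Lemma dconv_scale w a b f : {in monic &, {morph w : g h / g * h >-> g * h}} ->
  f \is monic -> w f * dconv a b f = dconv (fun g => w g * a g) (fun g => w g * b g) f.
Proof.
move=> wM fm; rewrite !(dconvE _ _ (leqnn _)) mulr_sumr !big_seq.
apply: eq_bigr => g; rewrite mem_monics => /andP[gm _].
rewrite mulr_sumr !big_seq; apply: eq_bigr => h; rewrite mem_monics => /andP[hm _].
by case: eqP => [<-|_]; rewrite ?mulr0 // wM // mulrACA.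
Qed.

(** * Iterating the convolution identity and bounding the error *)

Local Notation pabs := (@pabs F R).
Local Notation alpha := (@alphaGL F R).
Local Notation L := (@alpha_conv F R).

Lemma card_field_gt1 : 1 < #|F|%:R :> R.
Proof. by rewrite ltr1n card_finNzRing_gt1. Qed.

Lemma pabs_gt0 g : 0 < pabs g.
Proof. by rewrite exprn_gt0 // (lt_trans ltr01 card_field_gt1). Qed.

Lemma pabsM : {in monic &, {morph pabs : g h / g * h >-> g * h}}.
Proof.
move=> g h gm hm; rewrite /pabs -exprD; congr (_ ^+ _).
rewrite size_mul ?monic_neq0 //.
have := monic_neq0 gm; have := monic_neq0 hm; rewrite -!size_poly_gt0.
by case: (size g) => // ?; case: (size h) => // ? _ _; rewrite addnS.
Qed.

Lemma alpha_conv_factor G :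
    {in monic, G =1 dconv (alpha 1) (fun g => (pabs g)^-1 * G g)} ->
  forall k, {in monic, G =1 dconv (L k) (fun g => (pabs g) ^- k * G g)}.
Proof.
move=> GE; elim=> [|k IH] f fm.
  by rewrite /= dconv1 // expr0 invr1 mul1r.
rewrite IH //= -dconvA; apply: eq_dconv => // g gm.
have wM : {in monic &, {morph (fun p => pabs p ^- k) : p r / p * r >-> p * r}}.
  by move=> p r pm rm; rewrite pabsM // exprMn invfM.
(* The identity is substituted into the remaining factor; scaling by |.|^-k turns alpha_1 into
   alpha_(k+1) and |.|^-1 into |.|^-(k+1). *)
rewrite [G g]GE // (dconv_scale _ _ wM) //.
apply: eq_dconv => h hm.
  by rewrite /alphaGL; case: ifP; rewrite ?mulr0 // -invfM -exprD addn1.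
by rewrite mulrA -invfM -exprSr.
Qed.

Lemma dconv_ge0 a b f : {in monic, forall g, 0 <= a g} ->
  {in monic, forall g, 0 <= b g} -> 0 <= dconv a b f.
Proof.
move=> a0 b0; rewrite (dconvE _ _ (leqnn _)) big_seq sumr_ge0 // => g.
rewrite mem_monics => /andP[gm _]; rewrite big_seq sumr_ge0 // => h.
rewrite mem_monics => /andP[hm _]; case: ifP => // _.
by rewrite mulr_ge0 ?a0 ?b0.
Qed.

Lemma alpha_conv_ge0 k : {in monic, forall g, 0 <= L k g}.
Proof.
elim: k => [|k IH] g gm /=; first by rewrite /deltaP; case: ifP.
apply: dconv_ge0 => // h hm; rewrite /alphaGL; case: ifP => // _.
by rewrite invr_ge0 exprn_ge0 // ltW // pabs_gt0.
Qed.

Lemma dconv_split1 a b f : f \is monic ->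
  dconv a b f = a f * b 1 + \sum_(g <- monics (size f))
    \sum_(h <- monics (size f) | h != 1) (if g * h == f then a g * b h else 0).
Proof.
move=> fm; rewrite (dconvE _ _ (leqnn _)).
have f0 : (0 < size f)%N by rewrite size_poly_gt0 monic_neq0.
rewrite -(@sum_monics_pick (size f) f (fun g => a g * b 1)) ?mem_monics ?fm ?leqnn //.
rewrite -big_split; apply: eq_bigr => g _ /=.
by rewrite (bigD1_seq 1) ?monics_uniq ?mem_monics ?monic1 ?size_poly1 //= mulr1.
Qed.

Lemma alpha_conv_bounds G : G 1 = 1 -> {in monic, forall g, 0 <= G g} ->
    {in monic, G =1 dconv (alpha 1) (fun g => (pabs g)^-1 * G g)} ->
  forall k f, f \is monic ->
  L k f <= G f <= L k f + #|F|%:R ^- k * dconv G G f.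
Proof.
move=> G1 G0 /alpha_conv_factor GE k.
have q0 : 0 < #|F|%:R :> R := lt_trans ltr01 card_field_gt1.
have pG0 g : g \is monic -> 0 <= (pabs g) ^- k * G g.
  by move=> gm; rewrite mulr_ge0 ?G0 // invr_ge0 exprn_ge0 // ltW // pabs_gt0.
have LG f : f \is monic -> L k f <= G f.
  move=> fm; rewrite [G f](GE k) // dconv_split1 // G1 mulr1.
  rewrite /pabs size_poly1 /= expr0 expr1n invr1 mulr1 lerDl.
  rewrite big_seq sumr_ge0 // => g; rewrite mem_monics => /andP[gm _].
  rewrite big_seq_cond sumr_ge0 // => h; rewrite mem_monics => /andP[/andP[hm _] _].
  by case: ifP => // _; rewrite mulr_ge0 ?alpha_conv_ge0 ?pG0.
move=> f fm; rewrite LG //=.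
rewrite [G f](GE k) // dconv_split1 // G1 mulr1.
rewrite {1}/pabs size_poly1 /= expr0 expr1n invr1 mulr1 lerD2l.
rewrite (dconvE _ _ (leqnn _)) mulr_sumr !big_seq ler_sum // => g.
rewrite mem_monics => /andP[gm _]; rewrite mulr_sumr big_mkcond.
rewrite !big_seq ler_sum // => h.
rewrite mem_monics => /andP[hm _].
(* The term h = 1 is missing on the left, so there the nonnegativity of the right side suffices. *)
case: (h =P 1) => [_|h1] /=.
  by case: ifP; rewrite ?mulr0 // mulr_ge0 ?mulr_ge0 ?G0 // invr_ge0 exprn_ge0 // ltW.
case: ifP => _; last by rewrite mulr0.
(* A monic h other than 1 has |h| at least q, whence |h|^-k <= q^-k; the other factor is bounded by
   the lower half [LG], already proved. *)
rewrite mulrCA; apply: ler_pM.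
- by rewrite invr_ge0 exprn_ge0 // ltW // pabs_gt0.
- by rewrite mulr_ge0 ?alpha_conv_ge0 ?G0.
- rewrite lef_pV2 ?posrE ?exprn_gt0 ?pabs_gt0 //.
  rewrite lerXn2r ?nnegrE ?(ltW q0) ?(ltW (pabs_gt0 _)) //.
  rewrite -[leLHS]expr1 /pabs ler_eXn2l ?card_field_gt1 //.
  have hs : size h != 1%N by apply/eqP => /(monic_size1 hm) h_eq1; case: h1.
  have := monic_neq0 hm; rewrite -size_poly_gt0.
  by case: (size h) hs => [|[]].
- by rewrite ler_wpM2r ?G0 ?LG.
Qed.

End Convolution.

(** * The divisor-sum identity for characteristic polynomial frequencies *)

Section Frequencies.
Variables (F : finFieldType) (R : realType).
Implicit Types (f g h : {poly F}).
Local Notation PGL := (@PGL F R).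
Local Notation pabs := (@pabs F R).

Lemma char_poly_unitmx n (M : 'M[F]_n) : (M \in unitmx) = ((char_poly M).[0] != 0).
Proof. by rewrite horner_coef0 char_poly_det mulf_eq0 signr_eq0 unitmxE unitfE. Qed.

Lemma card_unitmx_neq0 n : #|[set M : 'M[F]_n | M \in unitmx]|%:R != 0 :> R.
Proof.
rewrite pnatr_eq0 -lt0n; apply/card_gt0P; exists 1%:M.
by rewrite inE unitmx1.
Qed.

Lemma PGL_root0 f : f \is monic -> f.[0] = 0 -> PGL f = 0.
Proof.
move=> fm f0; rewrite /Defs.PGL; case: eqP => [s0|_].
  have f1 : f = 1.
    apply: monic_size1 => //; have := monic_neq0 fm.
    by rewrite -size_poly_gt0; case: (size f) s0 => // ? /= ->.
  by move: f0; rewrite f1 hornerC => /eqP; rewrite oner_eq0.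
rewrite (_ : finset _ = finset.set0) ?cards0 ?mul0r //; apply/setP => M.
rewrite !inE char_poly_unitmx.
by case: (char_poly M =P f) => [->|_]; rewrite ?f0 ?eqxx ?andbF.
Qed.

(** Since f(0) is nonzero, every matrix with characteristic polynomial f is already invertible. *)
Lemma PGLE n f : f \is monic -> size f = n.+1 -> f.[0] != 0 ->
  PGL f = #|[set M : 'M[F]_n | char_poly M == f]|%:R /
          #|[set M : 'M[F]_n | M \in unitmx]|%:R.
Proof.
move=> fm fs f0; have en : n = (size f).-1 by rewrite fs.
have -> : [set M : 'M[F]_n | char_poly M == f] =
    [set M : 'M[F]_n | (M \in unitmx) && (char_poly M == f)].
  apply/setP => M; rewrite !inE char_poly_unitmx.
  by case: (char_poly M =P f) => [->|]; rewrite ?f0 ?andbF.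
(* Only degree 0 remains: every 0 x 0 matrix has characteristic polynomial 1, so the quotient is 1
   and agrees with the convention for f = 1. *)
subst n; rewrite /Defs.PGL; case: eqP => // s0; move: fs; rewrite s0 => fs.
rewrite [X in X%:R / _](_ : _ = #|[set M : 'M[F]_0 | M \in unitmx]|).
  by rewrite divff ?card_unitmx_neq0.
apply: eq_card => M; rewrite !inE (monic_size1 fm fs).
rewrite (monic_size1 (char_poly_monic M)) ?size_char_poly // eqxx andbT //.
Qed.

(** If g does not divide f, both sides vanish; otherwise the only surviving term is the cofactor h =
    f / g, which inherits h(0) nonzero. *)
Lemma sum_PGL_cofactor d m f g : f \is monic -> size f = (d + m).+1 -> f.[0] != 0 ->
  g \is monic -> size g = d.+1 ->
  \sum_(h <- monics F (d + m).+1) (if g * h == f then PGL h else 0) =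
  #|[set D : 'M[F]_m | g * char_poly D == f]|%:R /
  #|[set D : 'M[F]_m | D \in unitmx]|%:R.
Proof.
move=> fm fs f0 gm gs.
have [/dvdpP[h fE]|ndiv] := boolP (g %| f); last first.
  rewrite big1 => [|h _]; last first.
    by case: eqP => // E; case/negP: ndiv; rewrite -E dvdp_mulr.
  rewrite (_ : finset _ = finset.set0) ?cards0 ?mul0r //; apply/setP => D.
  by rewrite !inE; apply/eqP => E; case/negP: ndiv; rewrite -E dvdp_mulr.
have hm : h \is monic by move: fm; rewrite fE monicMr.
have gE x : (g * x == f) = (x == h).
  by rewrite fE mulrC (inj_eq (mulIf (monic_neq0 gm))).
have hs : size h = m.+1.
  move: fs; rewrite fE size_mul ?monic_neq0 // gs addnS /= addnC -addnS.
  by move/addnI.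
have h0 : h.[0] != 0 by move: f0; rewrite fE hornerM mulf_eq0 negb_or => /andP[].
under eq_bigr => x _ do rewrite gE.
rewrite sum_monics_pick ?mem_monics ?hm ?hs ?ltnS ?leq_addl // (PGLE hm hs h0).
by under [in RHS]eq_finset do rewrite gE.
Qed.

Lemma PGL_divisor_sum f : f \is monic -> f.[0] != 0 ->
  pabs f * PGL f = \sum_(g <- monics F (size f)) \sum_(h <- monics F (size f))
                     (if g * h == f then PGL h else 0).
Proof.
move=> fm f0; have := monic_neq0 fm; rewrite -size_poly_gt0.
case fs : (size f) => [//|n] _; rewrite (PGLE fm fs f0) /Defs.pabs fs /=.
rewrite mulrA -natrX -natrM card_char_poly_pairs natr_sum mulr_suml sum_monics.
apply: eq_bigr => -[d /=]; rewrite ltnS => dn _.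
(* Stratum by stratum in d = deg g. Dimension 0 means v = 0 and accounts for the divisor g = 1, that
   is, for the term P(f). *)
have [->|d0] := posnP d.
  have m1 (t : {ffun 'I_0 -> F}) : monic_of t = 1.
    by have [tm ts _] := monic_ofE t; exact: monic_size1.
  under eq_bigr => t _ do rewrite m1; rewrite sumr_const.
  rewrite card_ffun card_ord expn0 mulr1n card_cyclic_pairs0 -(PGLE fm fs f0).
  rewrite -[LHS](@sum_monics_pick _ _ n.+1) ?mem_monics ?fm ?fs ?leqnn //.
  by apply: eq_bigr => h _; rewrite mul1r.
(* Writing n as d + m gives the matrices the block shape required by [card_cyclic_pairs]. *)
have en : n = (d + (n - d))%N by rewrite subnKC.
move: (n - d)%N en => m en; subst n.
transitivity (\sum_(t : {ffun 'I_d -> F})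
   #|[set D : 'M[F]_m | monic_of t * char_poly D == f]|%:R /
   #|[set D : 'M[F]_m | D \in unitmx]|%:R : R).
  rewrite -mulr_suml -natr_sum; apply/eqP; rewrite eqr_div ?card_unitmx_neq0 //.
  rewrite -!natrM; apply/eqP; congr (_%:R); rewrite card_cyclic_pairs // mulnC.
  congr (_ * _)%N; rewrite -sum1dep_card.
  under [RHS]eq_bigr do rewrite -sum1dep_card.
  by rewrite pair_big_dep.
apply: eq_bigr => t _; have [tm ts _] := monic_ofE t.
by rewrite (sum_PGL_cofactor fm fs f0 tm ts).
Qed.

Lemma PGL_ge0 f : 0 <= PGL f.
Proof. by rewrite /Defs.PGL; case: ifP => // _; rewrite divr_ge0. Qed.

Lemma PGL_1 : PGL 1 = 1.
Proof. by rewrite /Defs.PGL size_poly1. Qed.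

Lemma PGL_dconv :
  {in monic, PGL =1 dconv (@alphaGL F R 1) (fun g => (pabs g)^-1 * PGL g)}.
Proof.
move=> f fm; rewrite (dconvE _ _ (leqnn _)).
(* When f(0) = 0, each factorization f = g h has g(0) = 0, which kills alpha_1(g), or h(0) = 0,
   which kills P(h). *)
have [f0|f0] := eqVneq f.[0] 0.
  rewrite PGL_root0 // big1_seq // => g /=; rewrite mem_monics => /andP[gm _].
  rewrite big1_seq // => h /=; rewrite mem_monics => /andP[hm _].
  case: eqP => // ghf; rewrite /alphaGL; case: eqP => [|/eqP g0]; rewrite ?mul0r //.
  rewrite (@PGL_root0 h) ?mulr0 //; move/eqP: f0.
  by rewrite -ghf hornerM mulf_eq0 (negPf g0) => /eqP.
apply: (mulfI (lt0r_neq0 (pabs_gt0 R f))); rewrite PGL_divisor_sum // mulr_sumr.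
rewrite !big_seq; apply: eq_bigr => g; rewrite mem_monics => /andP[gm _].
rewrite mulr_sumr !big_seq; apply: eq_bigr => h; rewrite mem_monics => /andP[hm _].
case: eqP => [ghf|_]; last by rewrite mulr0.
have g0 : g.[0] != 0 by move: f0; rewrite -ghf hornerM mulf_eq0 negb_or => /andP[].
rewrite /alphaGL g0 expr1 -ghf pabsM // [X in _ * X]mulrA -invfM mulrA divff ?mul1r //.
by rewrite mulf_neq0 // lt0r_neq0 ?pabs_gt0.
Qed.

End Frequencies.

(** * Passage to the limit *)

Unset Implicit Arguments.
Local Open Scope classical_set_scope.

Theorem theorem3p4 (F : finFieldType) (R : realType) (f : {poly F}) :
  f \is monic ->
  (fun k : nat => @alpha_conv F R k f) @ \oo --> @PGL F R f.
Proof.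
move=> fm; set G := @PGL F R.
have qk0 : (fun k => (#|F|%:R ^- k : R)) @ \oo --> (0 : R).
  under eq_fun do rewrite -exprVn -[_ ^+ _]mul1r.
  apply: cvg_geometric; rewrite ger0_norm ?invr_ge0 //.
  by rewrite invf_lt1 ?card_field_gt1 // (lt_trans ltr01 (card_field_gt1 F R)).
(* The upper bound on P(f), solved for the k-fold convolution; the constant (P * P)(f) does not
   depend on k. *)
have lower : (fun k => G f - #|F|%:R ^- k * dconv G G f) @ \oo --> G f.
  rewrite -[X in _ --> X]subr0 -[X in _ - X](mul0r (dconv G G f)).
  by apply: cvgB; [exact: cvg_cst | apply: cvgMl].
apply: (squeeze_cvgr _ lower (cvg_cst (G f))); apply: nearW => k.
have /andP[LG GL] := alpha_conv_bounds (PGL_1 F R) (fun g _ => PGL_ge0 R g)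
  (@PGL_dconv F R) k fm.
by rewrite LG andbT lerBlDr.
Qed.
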